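(* For every $p\in(0,1)$, the optimal (minimum) competitive ratio achievable by a monotone trajectory for $p$-Faulty Search on the half-line equals $$\frac{4+4\sqrt{1-p}}{2-p}-p .$$
   Context: Problem $p$-Faulty Search: a unit-speed robot starts at the origin of the half-line $[0,\infty)$; a treasure lies at an unknown distance $d\ge1$ from the origin. Each time the robot passes over the treasure it detects it independently with probability $p\in(0,1)$ (known to the robot); if the treasure lies exactly at a point where the robot changes direction, it is detected with probability $1$ there. For a trajectory $T$, $\mathbb{E}_T(d)$ denotes the expected time of first detection, i.e. $\sum_{i\ge1}p(1-p)^{i-1}f_i$ where $f_i$ is the time of the $i$-th pass over the treasure. The competitive ratio of $T$ is $\sup_{d\ge1} p\,\mathbb{E}_T(d)/d$. A monotone trajectory is determined by a strictly increasing sequence $(x_i)_{i\ge1}$ of positive reals with $x_i\to\infty$ (which may depend on $p$): the robot moves $0\to x_1\to 0\to x_2\to 0\to x_3\to\cdots$, i.e. it returns to the origin after each turning point $x_i$. *)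

(* Defs.v *)
From mathcomp Require Import all_boot all_order all_algebra.
From mathcomp Require Import all_classical all_reals all_analysis.

Set Implicit Arguments.
Unset Strict Implicit.
Unset Printing Implicit Defensive.

Import Order.TTheory GRing.Theory Num.Theory.
Import numFieldNormedType.Exports.

Local Open Scope classical_set_scope.
Local Open Scope ring_scope.

(* A trajectory is a position function [T] of time; only its values at times
   [t >= 0] are meaningful. *)

(* Time of the pass number [i] over the point [d], counted from [i = 0].
   It is meant for trajectories that visit [d] infinitely often and at isolated
   times, so that each infimum is a minimum. *)
Fixpoint pass_time (R : realType) (T : R -> R) (d : R) (i : nat) : R :=
  if i is j.+1 then inf [set t | pass_time T d j < t /\ T t = d]
  else inf [set t | 0 <= t /\ T t = d].

(* At unit speed, the robot changes direction exactly at the strict local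
   extrema of its position. *)
Definition changes_direction (R : realType) (T : R -> R) (t : R) : Prop :=
  (\forall s \near t^', T s < T t) \/ (\forall s \near t^', T t < T s).

Definition detection_prob (R : realType) (p : R) (T : R -> R) (t : R) : R :=
  if `[< changes_direction T t >] then 1 else p.

(* Equal to [(1 - p) ^+ i * p] when no pass over [d] is a change of
   direction. *)
Definition first_detection_prob (R : realType) (p : R) (T : R -> R) (d : R)
    (i : nat) : R :=
  (\prod_(j < i) (1 - detection_prob p T (pass_time T d j)))
  * detection_prob p T (pass_time T d i).

(* Possibly [+oo]: the series need not converge. *)
Definition expected_time (R : realType) (p : R) (T : R -> R) (d : R) : \bar R :=
  (\sum_(0 <= i <oo) (first_detection_prob p T d i * pass_time T d i)%:E)%E.

Definition competitive_ratio (R : realType) (p : R) (T : R -> R) : \bar R :=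
  ereal_sup [set (p%:E * expected_time p T d * d^-1%:E)%E | d in [set d | 1 <= d]].

(* Turning points are numbered from [0]. The robot leaves the origin towards
   [x n] at time [departure x n] and is back at time [departure x n.+1]. *)
Definition departure (R : realType) (x : nat -> R) (n : nat) : R :=
  2 * \sum_(i < n) x i.

Definition follows (R : realType) (x : nat -> R) (T : R -> R) : Prop :=
  forall n t, departure x n <= t <= departure x n.+1 ->
    T t = x n - `|t - (departure x n + x n)|.

Definition monotone_trajectory (R : realType) (T : R -> R) : Prop :=
  exists x : nat -> R,
    [/\ forall n, 0 < x n, forall n, x n < x n.+1,
        x n @[n --> \oo] --> +oo%R & follows x T].

(* Main.v *)
(* Write q = 1 - p = s ^ 2, and let D k be the time at which the robot leaves
   the origin towards x k. If x (k - 1) < d < x k, the passes over d happen at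
   the times D (k + j) + d and D (k + j + 1) - d, so that, with
   G k = \sum_j q ^ (2 j) * D (k + j), the expected detection time of d is
   p * d / (1 + q) + p * (G k + q * G (k + 1)).
   The worst case is d just beyond a turning point.

   Turning points in geometric progression, of the best base, reach the claimed
   ratio. Conversely, a smaller ratio would give, for
   S k = \sum_i q ^ (2 i) * x (k + i) = ((1 - q ^ 2) * G (k + 1) - D k) / 2
   and A k = D k / 2, inequalities A (k + 1) + q * S (k + 1) <= c * x k with c
   too small: the ratio S k / A k would then decrease by a fixed amount at each
   step, although it is bounded from below. *)
Require Import Defs.
From mathcomp Require Import all_boot all_order all_algebra.
From mathcomp Require Import all_classical all_reals all_analysis.
From mathcomp Require Import ring lra.

Set Implicit Arguments.
Unset Strict Implicit.
Unset Printing Implicit Defensive.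

Import Order.TTheory GRing.Theory Num.Theory.
Import numFieldNormedType.Exports.

Local Open Scope classical_set_scope.
Local Open Scope ring_scope.

(** * Excursions of the trajectory and pass times *)

Lemma inf_minimum (R : realType) (A : set R) (m : R) :
  A m -> lbound A m -> inf A = m.
Proof.
move=> Am lbm; apply/le_anti/andP; split.
  by apply: ge_inf => //; exists m.
by apply: lb_le_inf => //; exists m.
Qed.

Lemma departureS (R : realType) (x : nat -> R) n :
  departure x n.+1 = departure x n + 2 * x n.
Proof. by rewrite /departure big_ord_recr mulrDr. Qed.

Lemma departure0 (R : realType) (x : nat -> R) : departure x 0 = 0.
Proof. by rewrite /departure big_ord0 mulr0. Qed.

Lemma departure_le (R : realType) (x : nat -> R) (x_gt0 : forall n, 0 < x n)
    m n : (m <= n)%N -> departure x m <= departure x n.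
Proof.
move: m n; apply: (homo_leq lexx le_trans) => n.
by rewrite departureS lerDl mulr_ge0// ltW.
Qed.

Lemma departure_ge0 (R : realType) (x : nat -> R) (x_gt0 : forall n, 0 < x n)
    n : 0 <= departure x n.
Proof. by rewrite -(departure0 x) departure_le. Qed.

Lemma departure_ltn (R : realType) (x : nat -> R) (x_gt0 : forall n, 0 < x n)
    m n : departure x m < departure x n -> (m < n)%N.
Proof.
by move=> lt_mn; rewrite ltnNge; apply/negP => /(departure_le x_gt0); lra.
Qed.

Lemma departure_locate (R : realType) (x : nat -> R)
    (x_gt0 : forall n, 0 < x n) (x_cvg : x n @[n --> \oo] --> +oo%R) t :
  0 <= t -> exists n, departure x n <= t < departure x n.+1.
Proof.
move=> t0.
have exN : exists n, t < departure x n.+1.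
  have /cvgryPge/(_ t)[N _ /(_ N (leqnn N)) /= tx] := x_cvg.
  exists N; rewrite departureS.
  have := departure_ge0 x_gt0 N; have := x_gt0 N; lra.
case: (ex_minnP exN) => -[|n] tn n_min.
  by exists 0%N; rewrite tn departure0 t0.
exists n.+1; rewrite tn andbT leNgt; apply/negP => /n_min.
by rewrite ltnn.
Qed.

Lemma follows_rise (R : realType) (x : nat -> R) (T : R -> R) (fT : follows x T)
    n t : departure x n <= t <= departure x n + x n -> T t = t - departure x n.
Proof.
move=> /andP[t1 t2]; rewrite (fT n) ?departureS; last by lra.
by rewrite ler0_norm; lra.
Qed.

Lemma follows_fall (R : realType) (x : nat -> R) (T : R -> R) (fT : follows x T)
    n t : departure x n + x n <= t <= departure x n.+1 ->
  T t = departure x n.+1 - t.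
Proof.
rewrite departureS => /andP[t1 t2]; rewrite (fT n) ?departureS; last by lra.
by rewrite ger0_norm; lra.
Qed.

(** Inverts one excursion: the position determines the time up to the choice between outward and
    return leg. Together with [departure_locate], this bounds every candidate time in the infima
    defining [pass_time]. *)
Lemma follows_level (R : realType) (x : nat -> R) (T : R -> R)
    (fT : follows x T) n t : departure x n <= t <= departure x n.+1 ->
  T t <= x n /\ (t = departure x n + T t \/ t = departure x n.+1 - T t).
Proof.
move=> /andP[t1 t2].
have [t3|t3] := leP t (departure x n + x n).
  by rewrite (follows_rise fT (n := n)) ?t1//; split; [lra | left; lra].
rewrite (follows_fall fT (n := n)) ?t2 ?(ltW t3)//.
by move: t1 t2 t3; rewrite departureS => t1 t2 t3; split; [lra | right; lra].
Qed.

(** Excursions before [k] stay below [d], so a visit to [d] belongs to an excursion [n >= k]. The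
    case [d = x k] is included, to serve for a treasure at a turning point. *)
Lemma pass_time_first (R : realType) (x : nat -> R) (T : R -> R) d k
    (x_gt0 : forall n, 0 < x n) (x_cvg : x n @[n --> \oo] --> +oo%R)
    (fT : follows x T) (d_gt0 : 0 < d) (d_ge : forall n, (n < k)%N -> x n < d)
    (d_le : d <= x k) :
  pass_time T d 0 = departure x k + d.
Proof.
apply: inf_minimum => [/=|t /= [t0 Tt]].
  split; first by rewrite addr_ge0 ?departure_ge0// ltW.
  by rewrite (follows_rise fT (n := k)); lra.
have [n /andP[t1 t2]] := departure_locate x_gt0 x_cvg t0.
have [|dn td] := follows_level fT (n := n) (t := t); first by rewrite t1 ltW.
have kn : (k <= n)%N by rewrite leqNgt; apply/negP => /d_ge; lra.
have := departure_le x_gt0 kn.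
by move: td; rewrite departureS Tt => -[]; lra.
Qed.

Lemma inf_next_fall (R : realType) (x : nat -> R) (T : R -> R) d m
    (x_gt0 : forall n, 0 < x n) (x_cvg : x n @[n --> \oo] --> +oo%R)
    (fT : follows x T) (d_gt0 : 0 < d) (d_lt : d < x m) :
  inf [set t | departure x m + d < t /\ T t = d] = departure x m.+1 - d.
Proof.
apply: inf_minimum => [/=|t /= [t0 Tt]].
  rewrite (follows_fall fT (n := m)) departureS; lra.
have t_ge0 : 0 <= t by have := departure_ge0 x_gt0 m; lra.
have [n /andP[t1 t2]] := departure_locate x_gt0 x_cvg t_ge0.
have [|dn td] := follows_level fT (n := n) (t := t); first by rewrite t1 ltW.
have : (m < n.+1)%N by apply: (departure_ltn x_gt0); lra.
rewrite ltnS leq_eqVlt => /orP[/eqP mn|/(departure_le x_gt0)]; last by lra.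
by move: td; rewrite -mn Tt => -[]; lra.
Qed.

Lemma inf_next_rise (R : realType) (x : nat -> R) (T : R -> R) d m
    (x_gt0 : forall n, 0 < x n) (x_cvg : x n @[n --> \oo] --> +oo%R)
    (fT : follows x T) (d_gt0 : 0 < d) (d_lt : d < x m) (d_le : d <= x m.+1) :
  inf [set t | departure x m.+1 - d < t /\ T t = d] = departure x m.+1 + d.
Proof.
apply: inf_minimum => [/=|t /= [t0 Tt]].
  by rewrite (follows_rise fT (n := m.+1)); lra.
have Dm := departureS x m.
have t_ge0 : 0 <= t by have := departure_ge0 x_gt0 m; lra.
have [n /andP[t1 t2]] := departure_locate x_gt0 x_cvg t_ge0.
have [|dn td] := follows_level fT (n := n) (t := t); first by rewrite t1 ltW.
have : (m < n.+1)%N by apply: (departure_ltn x_gt0); lra.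
rewrite ltnS leq_eqVlt => /orP[/eqP mn|/(departure_le x_gt0) mn].
  by move: td; rewrite -mn Tt => -[]; lra.
by move: td; rewrite departureS Tt => -[]; lra.
Qed.

Lemma pass_time_formula (R : realType) (x : nat -> R) (T : R -> R) d k
    (x_gt0 : forall n, 0 < x n) (x_cvg : x n @[n --> \oo] --> +oo%R)
    (fT : follows x T) (d_gt0 : 0 < d) (d_ge : forall n, (n < k)%N -> x n < d)
    (d_lt : forall n, (k <= n)%N -> d < x n) j :
  pass_time T d j.*2 = departure x (k + j) + d /\
  pass_time T d j.*2.+1 = departure x (k + j).+1 - d.
Proof.
have passS i : pass_time T d i.+1 = inf [set t | pass_time T d i < t /\ T t = d].
  by [].
(* Passes alternate: the return leg of an excursion follows its outward leg, and the outward leg of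
   the next excursion follows that. *)
elim: j => [|j [_ IHj]].
  have first_pass : pass_time T d 0.*2 = departure x (k + 0) + d.
    by rewrite addn0; apply: pass_time_first => //; apply/ltW/d_lt.
  split=> //.
  by rewrite passS first_pass (inf_next_fall x_gt0)// d_lt// leq_addr.
have even_pass : pass_time T d j.+1.*2 = departure x (k + j.+1) + d.
  rewrite doubleS passS IHj addnS (inf_next_rise x_gt0) ?d_lt ?leq_addr//.
  by apply/ltW/d_lt; rewrite -addnS leq_addr.
split=> //.
by rewrite passS even_pass (inf_next_fall x_gt0)// d_lt// leq_addr.
Qed.

(** * Changes of direction *)

(** At a strict extremum, [T (t + h)] and [T (t - h)] would lie on the same side of [T t] for some
    small [h > 0], whereas a nonzero slope puts them on opposite sides. *)
Lemma affine_not_changes_direction (R : realType) (T : R -> R) (t e a : R) :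
  0 < e -> a != 0 -> (forall s, `|s - t| < e -> T s = T t + a * (s - t)) ->
  ~ changes_direction T t.
Proof.
move=> e0 a0 Taff.
have two_sided (P : R -> Prop) : (\forall s \near t^', P s) ->
    exists h, [/\ 0 < h, h < e, P (t + h) & P (t - h)].
  move=> /nbhs_ballP[r /= r0 rP]; set m := Num.min r e.
  have m0 : 0 < m by rewrite lt_min r0.
  have mr : m <= r by rewrite ge_min lexx.
  have me : m <= e by rewrite ge_min lexx orbT.
  exists (m / 2); split; [lra | lra | |].
    apply: rP; last by rewrite gt_eqF//; lra.
    by rewrite /ball /= ltr_norml; lra.
  apply: rP; last by rewrite lt_eqF//; lra.
  by rewrite /ball /= ltr_norml; lra.
have affE h : 0 < h -> h < e ->
    T (t + h) = T t + a * h /\ T (t - h) = T t - a * h.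
  move=> h0 he; split; rewrite Taff ?ltr_norml; [| lra | | lra].
    by congr (_ + _ * _); ring.
  by ring.
by case=> /two_sided[h [/affE Th /Th[-> ->]]]; lra.
Qed.

Lemma changes_direction_turning (R : realType) (x : nat -> R) (T : R -> R) k :
  follows x T -> 0 < x k -> changes_direction T (departure x k + x k).
Proof.
move=> fT xk; left; apply/nbhs_ballP; exists (x k) => //= s.
rewrite /ball /= ltr_norml => sk s_neq.
have [s_lt|s_gt|s_eq] := ltgtP s (departure x k + x k); last first.
- by rewrite s_eq eqxx in s_neq.
- rewrite (follows_rise fT (n := k) (t := _ + _)); last by lra.
  by rewrite (follows_fall fT (n := k)) departureS; lra.
- rewrite (follows_rise fT (n := k) (t := _ + _)); last by lra.
  by rewrite (follows_rise fT (n := k)); lra.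
Qed.

Lemma not_changes_direction_rise (R : realType) (x : nat -> R) (T : R -> R) n d :
  follows x T -> 0 < d < x n -> ~ changes_direction T (departure x n + d).
Proof.
move=> fT /andP[d0 dx].
(* The radius is the distance from [d] to the nearer end of the outward leg. *)
apply: (@affine_not_changes_direction _ _ _ (Num.min d (x n - d)) 1).
- by rewrite lt_min d0 subr_gt0.
- exact: oner_neq0.
- move=> s; rewrite lt_min !ltr_norml => s_near.
  by rewrite !(follows_rise fT (n := n)); lra.
Qed.

Lemma not_changes_direction_fall (R : realType) (x : nat -> R) (T : R -> R) n d :
  follows x T -> 0 < d < x n -> ~ changes_direction T (departure x n.+1 - d).
Proof.
move=> fT /andP[d0 dx].
apply: (@affine_not_changes_direction _ _ _ (Num.min d (x n - d)) (-1)).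
- by rewrite lt_min d0 subr_gt0.
- by rewrite oppr_eq0 oner_neq0.
- have Dn := departureS x n; move=> s; rewrite lt_min !ltr_norml => s_near.
  by rewrite !(follows_fall fT (n := n)); lra.
Qed.

(** * Detection probabilities and partial sums of the expected time *)

Lemma pass_time_ge0 (R : realType) (T : R -> R) d i : 0 <= pass_time T d i.
Proof.
have inf_ge0 (A : set R) : lbound A 0 -> 0 <= inf A.
  (* If [d] is not visited again, the set is empty and [inf] takes its default value 0. *)
  have [->|] := eqVneq A set0; first by rewrite inf0.
  by move=> /set0P A0 lbA; apply: lb_le_inf.
elim: i => [|i IHi]; apply: inf_ge0 => t /= [] //.
by move=> lt_t _; apply: le_trans IHi (ltW lt_t).
Qed.

Lemma detection_prob_itv (R : realType) (p : R) (T : R -> R) t :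
  0 < p < 1 -> 0 <= detection_prob p T t <= 1.
Proof. by move=> hp; rewrite /detection_prob; case: ifP; lra. Qed.

Lemma first_detection_prob_ge0 (R : realType) (p : R) (T : R -> R) d i :
  0 < p < 1 -> 0 <= first_detection_prob p T d i.
Proof.
move=> hp; have dp t := detection_prob_itv T t hp.
apply: mulr_ge0; last by case/andP: (dp (pass_time T d i)).
by apply: prodr_ge0 => j _; rewrite subr_ge0; case/andP: (dp (pass_time T d j)).
Qed.

Lemma first_detection_prob_generic (R : realType) (p : R) (T : R -> R) d i :
  (forall j, ~ changes_direction T (pass_time T d j)) ->
  first_detection_prob p T d i = (1 - p) ^+ i * p.
Proof.
move=> no_turn; rewrite /first_detection_prob /detection_prob asboolF//.
under eq_bigr do rewrite asboolF//.
by rewrite prodr_const card_ord.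
Qed.

Lemma first_detection_prob_turning (R : realType) (p : R) (T : R -> R) d i :
  changes_direction T (pass_time T d 0) ->
  first_detection_prob p T d i = (i == 0%N)%:R.
Proof.
move=> turn; rewrite /first_detection_prob; case: i => [|i].
  by rewrite big_ord0 /detection_prob asboolT// mul1r.
by rewrite big_ord_recl /= /detection_prob asboolT// subrr !mul0r.
Qed.

Lemma sum_double (V : nmodType) (u : nat -> V) n :
  \sum_(i < n.*2) u i = \sum_(j < n) (u j.*2 + u j.*2.+1).
Proof.
elim: n => [|n IHn]; first by rewrite !big_ord0.
by rewrite doubleS !big_ord_recr /= IHn addrA.
Qed.

(** Terms are nonnegative, so the partial sum of length [n] is at most that of length [n.*2]; sums
    of even length group the two passes of each excursion. *)
Lemma expected_time_le (R : realType) (p : R) (T : R -> R) d B :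
  0 < p < 1 ->
  (forall n, \sum_(i < n.*2) first_detection_prob p T d i * pass_time T d i
    <= B) ->
  (expected_time p T d <= B%:E)%E.
Proof.
move=> hp sum_le.
have u_ge0 i : 0 <= first_detection_prob p T d i * pass_time T d i.
  by rewrite mulr_ge0 ?first_detection_prob_ge0 ?pass_time_ge0.
apply: lime_le.
  by apply: is_cvg_ereal_nneg_natsum => n _; rewrite lee_fin.
apply: nearW => n; rewrite sumEFin lee_fin big_mkord; apply: le_trans (sum_le n).
by rewrite -addnn big_split_ord /= lerDl sumr_ge0.
Qed.

Lemma expected_time_ge (R : realType) (p : R) (T : R -> R) d n :
  0 < p < 1 ->
  ((\sum_(i < n) first_detection_prob p T d i * pass_time T d i)%:E
    <= expected_time p T d)%E.
Proof.
move=> hp; rewrite -sumEFin -(big_mkord xpredT (fun i =>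
  (first_detection_prob p T d i * pass_time T d i)%:E)).
apply: nneseries_lim_ge => i _ _.
by rewrite lee_fin mulr_ge0 ?first_detection_prob_ge0 ?pass_time_ge0.
Qed.

(* Passes [2j] and [2j+1] are the two passes on the excursion to [x (k + j)]. *)
Lemma partial_expected_time (R : realType) (p : R) (x : nat -> R) (T : R -> R)
    d k (x_gt0 : forall n, 0 < x n) (x_cvg : x n @[n --> \oo] --> +oo%R)
    (fT : follows x T) (d_gt0 : 0 < d) (d_gt : forall n, (n < k)%N -> x n < d)
    (d_lt : forall n, (k <= n)%N -> d < x n) n :
  \sum_(i < n.*2) first_detection_prob p T d i * pass_time T d i =
  \sum_(j < n) ((1 - p) ^+ 2) ^+ j * (p * (p * d + departure x (k + j)
                                       + (1 - p) * departure x (k + j).+1)).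
Proof.
have passE := pass_time_formula x_gt0 x_cvg fT d_gt0 d_gt d_lt.
have no_turn i : ~ changes_direction T (pass_time T d i).
  have d_itv m : 0 < d < x (k + m) by rewrite d_gt0 d_lt// leq_addr.
  rewrite -(odd_double_half i); case: (odd i); rewrite ?add1n ?add0n.
    by rewrite (passE _).2; apply: not_changes_direction_fall.
  by rewrite (passE _).1; apply: not_changes_direction_rise.
rewrite (sum_double (fun i => first_detection_prob p T d i * pass_time T d i)).
apply: eq_bigr => j _.
rewrite !first_detection_prob_generic// (passE _).1 (passE _).2.
(* The contributions [d] of the outward pass and [- (1 - p) * d] of the return pass merge into
   [p * d]. *)
by rewrite exprS -mul2n exprM; ring.
Qed.

Lemma follows_exists (R : realType) (x : nat -> R)
    (x_gt0 : forall n, 0 < x n) (x_cvg : x n @[n --> \oo] --> +oo%R) :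
  exists T, follows x T.
Proof.
pose excursion t := xget 0%N [set n | departure x n <= t < departure x n.+1].
exists (fun t => x (excursion t)
  - `|t - (departure x (excursion t) + x (excursion t))|) => n t /andP[t1 t2].
have t0 : 0 <= t := le_trans (departure_ge0 x_gt0 n) t1.
have := xgetPex 0%N (departure_locate x_gt0 x_cvg t0).
rewrite -/(excursion t); move: (excursion t) => m /= /andP[t3 t4].
have : (n < m.+1)%N by apply: (departure_ltn x_gt0); lra.
rewrite ltnS leq_eqVlt => /orP[/eqP -> //|nm].
have := departure_le x_gt0 nm; rewrite departureS => Dm.
(* Here [n < m], so [t] is the common endpoint of two adjacent excursions, where both formulas give
   position 0. *)
rewrite (_ : t - (departure x m + x m) = - x m); last first.
  by rewrite departureS in t2; lra.
rewrite (_ : t - (departure x n + x n) = x n); last first.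
  by rewrite departureS in t2; lra.
by rewrite normrN !gtr0_norm// !subrr.
Qed.

(** * Upper bound: turning points in geometric progression *)

Lemma geometric_sum_le (R : realFieldType) (a : R) n :
  0 <= a < 1 -> \sum_(i < n) a ^+ i <= (1 - a)^-1.
Proof.
move=> /andP[a0 a1]; have sumE := subrX1 a n.
rewrite -[leRHS]mul1r ler_pdivlMr; last by lra.
by have := exprn_ge0 n a0; lra.
Qed.

Lemma departure_geometric_le (R : realType) (b : R) n : 1 < b ->
  departure (fun i => b ^+ i) n <= 2 / (b - 1) * b ^+ n.
Proof.
move=> b1; have sumE := subrX1 b n; rewrite /departure.
set S := \sum_(i < n) _ in sumE *.
rewrite mulrAC ler_pdivlMr; last by lra.
by rewrite -mulrA (mulrC S) -sumE; lra.
Qed.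

Lemma ratio_le (R : realType) (p : R) (T : R -> R) d B c :
  0 < p < 1 -> 0 < d -> (expected_time p T d <= B%:E)%E -> p * B <= c * d ->
  (p%:E * expected_time p T d * d^-1%:E <= c%:E)%E.
Proof.
move=> /andP[p0 _] d0 EB pB; apply: (@le_trans _ _ (p * B * d^-1)%:E).
  rewrite 2!EFinM; apply: lee_wpmul2r; first by rewrite lee_fin invr_ge0 ltW.
  by apply: lee_wpmul2l => //; rewrite lee_fin ltW.
by rewrite lee_fin ler_pdivrMr.
Qed.

Lemma expected_time_turning_le (R : realType) (p : R) (x : nat -> R)
    (T : R -> R) k (hp : 0 < p < 1) (x_gt0 : forall n, 0 < x n)
    (x_cvg : x n @[n --> \oo] --> +oo%R) (fT : follows x T)
    (x_gt : forall n, (n < k)%N -> x n < x k) :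
  (expected_time p T (x k) <= (departure x k + x k)%:E)%E.
Proof.
have pass0 := pass_time_first x_gt0 x_cvg fT (x_gt0 k) x_gt (lexx _).
apply: expected_time_le => // -[|n].
  by rewrite big_ord0 addr_ge0 ?departure_ge0// ltW.
have turn : changes_direction T (pass_time T (x k) 0).
  by rewrite pass0; apply: changes_direction_turning.
rewrite doubleS big_ord_recl big1 => [|i _].
  by rewrite first_detection_prob_turning// mul1r pass0 addr0.
by rewrite first_detection_prob_turning// mul0r.
Qed.

(* With [u] the inverse of the base, minimizing [1 / (1 - u) + q / (u - q ^ 2)],
   where [q = 1 - p = s ^ 2], over [q ^ 2 < u < 1] gives
   [u - q ^ 2 = s * (1 - u)], whose solution is this [u]. *)
Definition optimal_base (R : realType) (s : R) : R :=
  (s * (1 - s + s ^+ 2))^-1.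

Lemma optimal_base_itv (R : realType) (s : R) : 0 < s < 1 ->
  [/\ 1 < optimal_base s & s ^+ 4 * optimal_base s < 1].
Proof.
move=> /andP[s0 s1]; have u0 : 0 < s * (1 - s + s ^+ 2).
  by rewrite mulr_gt0// addr_gt0 ?exprn_gt0// subr_gt0.
(* With [u] the inverse of the base, this product is [1 - u], and [s] times it is [u - s ^+ 4]; the
   two claims are [u < 1] and [s ^+ 4 < u]. *)
have w0 : 0 < (1 - s) * (1 + s ^+ 2).
  by rewrite mulr_gt0 ?subr_gt0// addr_gt0 ?exprn_gt0.
rewrite /optimal_base; split.
  rewrite -[ltRHS]mul1r ltr_pdivlMr// mul1r; lra.
rewrite ltr_pdivrMr// mul1r.
have := mulr_gt0 s0 w0; lra.
Qed.

(** The left side is the coefficient of [b ^+ k] obtained by summing the discounted departure times.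
    In [u = b^-1] it equals [2 * (u + s ^+ 2) / ((1 - u) * (u - s ^+ 4))], where
    [u - s ^+ 4 = s * (1 - u)] and [u + s ^+ 2 = s * (1 + s ^+ 2)]. *)
Lemma optimal_base_gain (R : realType) (s : R) (b := optimal_base s) :
  0 < s < 1 ->
  2 / (b - 1) * (1 + s ^+ 2 * b) * b / (1 - s ^+ 4 * b) =
  2 / ((1 - s) ^+ 2 * (1 + s ^+ 2)).
Proof.
move=> /andP[s0 s1]; rewrite /b /optimal_base.
have v0 : 0 < 1 - s + s ^+ 2 by rewrite addr_gt0 ?exprn_gt0// subr_gt0.
have w0 : 0 < (1 - s) * (1 + s ^+ 2).
  by rewrite mulr_gt0 ?subr_gt0// addr_gt0 ?exprn_gt0.
have sw0 := mulr_gt0 s0 w0.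
field.
rewrite !gt_eqF//; lra.
Qed.

Lemma cvg_expr_pinfty (R : realType) (b : R) :
  1 < b -> (b ^+ n @[n --> \oo] --> +oo%R).
Proof.
move=> b1; have b0 : 0 < b by lra.
(* Bernoulli's inequality. *)
have bound n : 1 + n%:R * (b - 1) <= b ^+ n.
  elim: n => [|n IHn]; first by rewrite mul0r addr0 expr0.
  rewrite exprS; apply: le_trans (_ : b * (1 + n%:R * (b - 1)) <= _).
    rewrite -natr1; have : 0 <= n%:R * (b - 1) ^+ 2 by rewrite mulr_ge0 ?sqr_ge0.
    lra.
  by rewrite ler_wpM2l// ltW.
apply/cvgryPge => A; near=> n; apply: le_trans (bound n).
have : A / (b - 1) <= n%:R by near: n; exact: nbhs_infty_ger.
rewrite ler_pdivrMr; lra.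
Unshelve. all: by end_near. Qed.

Lemma expected_time_geometric_le (R : realType) (s : R) (T : R -> R) d k
    (b := optimal_base s) (p := 1 - s ^+ 2) :
  0 < s < 1 -> follows (fun n => b ^+ n) T ->
  b ^+ k < d -> d < b ^+ k.+1 ->
  (expected_time p T d <= (p / (1 + s ^+ 2) * d
     + p * (2 / ((1 - s) ^+ 2 * (1 + s ^+ 2)) * b ^+ k))%:E)%E.
Proof.
move=> s_itv fT d_gt d_lt.
have [b_gt1 sb_lt1] := optimal_base_itv s_itv; rewrite -/b in b_gt1 sb_lt1.
have /andP[s0 s1] := s_itv.
have b_gt0 : 0 < b by lra.
have hs2 : 0 < s ^+ 2 < 1 by rewrite exprn_gt0// exprn_ilt1// ltW.
have hp : 0 < p < 1 by rewrite /p; lra.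
have bX_gt0 n : 0 < b ^+ n by rewrite exprn_gt0.
have bX_le m n : (m <= n)%N -> b ^+ m <= b ^+ n.
  by move=> mn; rewrite ler_weXn2l// ltW.
have d_gt0 : 0 < d by apply: lt_trans d_gt.
apply: expected_time_le => // n.
rewrite (partial_expected_time p bX_gt0 (cvg_expr_pinfty b_gt1) fT (k := k.+1))//.
- rewrite {1}/p opprB addrCA subrr addr0.
  pose g := 2 / (b - 1) * (1 + s ^+ 2 * b).
  (* Bounding each departure by [2 / (b - 1)] times a power of [b] splits the sum into two geometric
     series, of ratios [s ^+ 4] and [s ^+ 4 * b], both below 1. *)
  have term_le (j : 'I_n) : ((s ^+ 2) ^+ 2) ^+ j * (p * (p * d
      + departure (fun i => b ^+ i) (k.+1 + j)
      + s ^+ 2 * departure (fun i => b ^+ i) (k.+1 + j).+1)) <=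
    p * (p * d) * (s ^+ 4) ^+ j + p * (g * b ^+ k.+1) * (s ^+ 4 * b) ^+ j.
    rewrite -[(s ^+ 2) ^+ 2]exprM [(s ^+ 4 * b) ^+ j]exprMn.
    have -> : p * (p * d) * (s ^+ 4) ^+ j
       + p * (g * b ^+ k.+1) * ((s ^+ 4) ^+ j * b ^+ j) =
       (s ^+ 4) ^+ j * (p * (p * d + 2 / (b - 1) * b ^+ (k.+1 + j)
         + s ^+ 2 * (2 / (b - 1) * b ^+ (k.+1 + j).+1))).
      by rewrite /g [b ^+ (k.+1 + j).+1]exprS exprD; ring.
    have s2 : 0 <= s ^+ 2 by lra.
    have p_ge0 : 0 <= p by lra.
    rewrite ler_wpM2l ?exprn_ge0 ?(ltW s0)// ler_wpM2l// lerD//.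
      by rewrite lerD// departure_geometric_le.
    by rewrite ler_wpM2l// departure_geometric_le.
  apply: le_trans (ler_sum _ (fun j _ => term_le j)) _.
  rewrite big_split /= -!mulr_sumr.
  have s4 : 0 <= s ^+ 4 < 1 by rewrite exprn_ge0 ?exprn_ilt1 ?ltW.
  have sb : 0 <= s ^+ 4 * b < 1 by rewrite sb_lt1 mulr_ge0 ?(ltW b_gt0)//; lra.
  have p_gt0 : 0 < p by lra.
  have g_gt0 : 0 < g.
    by rewrite /g mulr_gt0 ?divr_gt0 ?subr_gt0 ?addr_gt0 ?mulr_gt0 ?exprn_gt0.
  have pd : 0 <= p * (p * d) by rewrite !mulr_ge0// ltW.
  have pg : 0 <= p * (g * b ^+ k.+1).
    by apply/ltW/mulr_gt0 => //; apply: mulr_gt0.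
  apply: le_trans (lerD (ler_wpM2l pd (geometric_sum_le n s4))
                        (ler_wpM2l pg (geometric_sum_le n sb))) _.
  rewrite le_eqVlt; apply/orP; left; apply/eqP; congr (_ + _).
    by rewrite /p; field; lra.
  by rewrite -(optimal_base_gain s_itv) -/b /g [b ^+ k.+1]exprS; ring.
- move=> i; rewrite ltnS => ik; exact: le_lt_trans (bX_le _ _ ik) d_gt.
- by move=> i ki; apply: lt_le_trans d_lt (bX_le _ _ ki).
Qed.

Lemma competitive_ratio_geometric_le (R : realType) (s : R) (T : R -> R) :
  0 < s < 1 -> follows (fun n => optimal_base s ^+ n) T ->
  (competitive_ratio (1 - s ^+ 2) T
     <= ((4 + 4 * s) / (1 + s ^+ 2) - (1 - s ^+ 2))%:E)%E.
Proof.
move=> s_itv; have [] := optimal_base_itv s_itv.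
set b := optimal_base s; set p := 1 - s ^+ 2 => b_gt1 sb_lt1 fT.
have /andP[s0 s1] := s_itv.
have b_gt0 : 0 < b by lra.
have hs2 : 0 < s ^+ 2 < 1 by rewrite exprn_gt0// exprn_ilt1// ltW.
have hp : 0 < p < 1 by rewrite /p; lra.
have bX_gt0 n : 0 < b ^+ n by rewrite exprn_gt0.
apply: ge_ereal_sup => _ [d /= d1 <-].
have d0 : 0 < d by lra.
have /cvgryPge/(_ d)[N _ /(_ N (leqnn N)) /= dN] := cvg_expr_pinfty b_gt1.
have exN : exists n, d <= b ^+ n by exists N.
case: (ex_minnP exN) => k dk k_min.
have d_gt n : (n < k)%N -> b ^+ n < d.
  by rewrite ltnNge ltNge; apply: contra; exact: k_min.
have [d_eq|d_neq] := eqVneq d (b ^+ k).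
  rewrite d_eq in d_gt *.
  apply: (ratio_le hp) => //.
    exact: expected_time_turning_le hp bX_gt0 (cvg_expr_pinfty b_gt1) fT d_gt.
  apply: (@le_trans _ _ (p * (2 / (b - 1) * b ^+ k + b ^+ k))).
    by rewrite ler_wpM2l ?lerD// ?departure_geometric_le//; lra.
  rewrite -[X in _ + X]mul1r -mulrDl mulrA ler_wpM2r ?(ltW (bX_gt0 k))//.
  rewrite -subr_ge0.
  (* At a turning point detection is certain on the first pass, and the claimed ratio is met with
     positive slack. *)
  have -> : (4 + 4 * s) / (1 + s ^+ 2) - p - p * (2 / (b - 1) + 1) =
      2 * (1 + s) / (1 + s ^+ 2).
    rewrite /p /b /optimal_base.
    have v0 : 0 < 1 - s + s ^+ 2 by lra.
    have w0 : 0 < (1 - s) * (1 + s ^+ 2) by rewrite mulr_gt0 ?subr_gt0//; lra.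
    have sw0 := mulr_gt0 s0 w0.
    by field; rewrite !gt_eqF//; lra.
  by rewrite divr_ge0//; lra.
case: k dk k_min d_gt d_neq => [|k] dk k_min d_gt d_neq.
  (* Since [d >= 1 = b ^+ 0], the case [k = 0] forces [d] to be the first turning point. *)
  by move: d_neq dk; rewrite expr0 => d_neq dk; case/negP: d_neq; apply/eqP; lra.
have bk_d : b ^+ k < d by apply: d_gt.
have d_bk : d < b ^+ k.+1 by rewrite lt_neqAle d_neq.
apply: (ratio_le hp d0 (expected_time_geometric_le s_itv fT bk_d d_bk)).
rewrite -subr_ge0 -/p.
(* The slack is a positive multiple of [d - b ^+ k]: it vanishes as [d] decreases to the turning
   point. *)
have -> : ((4 + 4 * s) / (1 + s ^+ 2) - p) * d - p * (p / (1 + s ^+ 2) * d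
    + p * (2 / ((1 - s) ^+ 2 * (1 + s ^+ 2)) * b ^+ k)) =
    2 * (1 + s) ^+ 2 / (1 + s ^+ 2) * (d - b ^+ k).
  by rewrite /p; field; rewrite !gt_eqF//; lra.
by rewrite mulr_ge0 ?divr_ge0 ?sqr_ge0//; lra.
Qed.

(** * Lower bound: the recurrence on turning points *)

(* Going backwards, the ratio [S n / A n] is mapped above a Moebius function
   of [S n.+1 / A n.+1] which has no fixed point when [c] is too small, so
   forwards it decreases by a fixed amount at each step. *)
Lemma no_slow_expansion (R : realType) (s c : R) (A S x : nat -> R) :
  0 < s < 1 -> 1 + s ^+ 2 <= c * (1 - s ^+ 4) < (1 + s) ^+ 2 ->
  (forall n, 0 < A n) -> (forall n, 0 < x n) -> (forall n, 0 <= A n + S n) ->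
  (forall n, A n.+1 = A n + x n) -> (forall n, S n = x n + s ^+ 4 * S n.+1) ->
  (forall n, A n.+1 + s ^+ 2 * S n.+1 <= c * x n) -> False.
Proof.
move=> /andP[s0 s1] /andP[c_ge c_lt] A0 x0 AS_ge0 AE SE AS_le.
have s4 : 0 < 1 - s ^+ 4 by rewrite subr_gt0 exprn_ilt1// ltW.
have c0 : 0 < c.
  by rewrite -(pmulr_lgt0 _ s4); apply: lt_le_trans c_ge; have := sqr_ge0 s; lra.
(* Normalizes [c] so that the hypothesis on it reads [0 <= m < 1]. The form [A ^+ 2 - 2 * m * s * A
   * S + s ^+ 2 * S ^+ 2] is then positive definite, which is the absence of a fixed point. *)
pose m := (c * (1 - s ^+ 4) - 1 - s ^+ 2) / (2 * s).
have mE : c * (1 - s ^+ 4) = 1 + s ^+ 2 + 2 * s * m by rewrite /m; field; lra.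
have m0 : 0 <= m by rewrite /m divr_ge0; lra.
have m1 : m < 1 by rewrite /m ltr_pdivrMr; lra.
pose r n := S n / A n; pose e := (1 - m) / c.
have e0 : 0 < e by rewrite divr_gt0 ?subr_gt0.
have r_step n : r n.+1 <= r n - e.
  rewrite -subr_ge0.
  have -> : r n - e - r n.+1 =
      (S n * A n.+1 - S n.+1 * A n - e * (A n * A n.+1)) / (A n * A n.+1).
    by rewrite /r; field; rewrite !gt_eqF.
  apply: divr_ge0; last by rewrite mulr_ge0 ?ltW.
  rewrite -(pmulr_rge0 _ c0) mulrBr mulrA [c * e]mulrCA divff ?gt_eqF// mulr1.
  have Ax : 0 <= A n.+1 - A n by rewrite AE; have := x0 n; lra.
  have An : A n = A n.+1 - x n by rewrite AE; ring.
  have h1 : 0 <= (c * x n - (A n.+1 + s ^+ 2 * S n.+1)) * (A n.+1 + S n.+1).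
    by rewrite mulr_ge0// subr_ge0.
  have h2 : 0 <= m * (A n.+1 - s * S n.+1) ^+ 2 by rewrite mulr_ge0 ?sqr_ge0.
  have h3 : 0 <= (1 - m) * (s * S n.+1) ^+ 2.
    by rewrite mulr_ge0 ?sqr_ge0// subr_ge0 ltW.
  have h4 : 0 <= (1 - m) * (A n.+1 * (A n.+1 - A n)).
    by rewrite !mulr_ge0// ltW// subr_gt0.
  (* A certificate of nonnegativity: the first four terms are [h1] to [h4], and the last vanishes by
     [mE]. *)
  have -> : c * (S n * A n.+1 - S n.+1 * A n) - (1 - m) * (A n * A n.+1) =
    (c * x n - (A n.+1 + s ^+ 2 * S n.+1)) * (A n.+1 + S n.+1)
    + m * (A n.+1 - s * S n.+1) ^+ 2 + (1 - m) * (s * S n.+1) ^+ 2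
    + (1 - m) * (A n.+1 * (A n.+1 - A n))
    + (1 + s ^+ 2 + 2 * s * m - c * (1 - s ^+ 4)) * (A n.+1 * S n.+1).
    by rewrite SE An; ring.
  by rewrite mE subrr mul0r addr0 !addr_ge0.
have r_le n : r n <= r 0%N - n%:R * e.
  elim: n => [|n IHn]; first by rewrite mul0r subr0.
  by have := r_step n; rewrite -natr1; lra.
have r_ge n : -1 <= r n.
  by rewrite /r ler_pdivlMr// mulN1r; have := AS_ge0 n; lra.
have [N rN] : exists N : nat, (r 0%N + 1) / e < N%:R.
  eexists; exact: le_lt_trans (ler_norm _) (archi_boundP (normr_ge0 _)).
rewrite ltr_pdivrMr// in rN.
by have := r_le N; have := r_ge N; lra.
Qed.

(** * Lower bound: discounted sums of departure times *)

(** For [a = q ^ 2], the truncation of the series [G k], whose convergence is deduced later from a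
    finite competitive ratio. *)
Definition discounted (R : realType) (a : R) (D : nat -> R) (k N : nat) : R :=
  \sum_(j < N) a ^+ j * D (k + j)%N.

Lemma discountedS (R : realType) (a : R) (D : nat -> R) k N :
  discounted a D k N.+1 = D k + a * discounted a D k.+1 N.
Proof.
rewrite /discounted big_ord_recl mul1r addn0 mulr_sumr; congr (_ + _).
by apply: eq_bigr => j _; rewrite exprS mulrA -addSnnS.
Qed.

Lemma discounted_ge0 (R : realType) (a : R) (D : nat -> R) k N :
  0 <= a -> (forall n, 0 <= D n) -> 0 <= discounted a D k N.
Proof. by move=> a0 D0; apply: sumr_ge0 => j _; rewrite mulr_ge0 ?exprn_ge0. Qed.

Lemma discounted_is_cvg (R : realType) (a : R) (D : nat -> R) k M :
  0 <= a -> (forall n, 0 <= D n) -> (forall N, discounted a D k N <= M) ->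
  cvgn (discounted a D k).
Proof.
move=> a0 D0 leM; apply: nondecreasing_is_cvgn; last by exists M => _ [N _ <-].
apply/nondecreasing_seqP => N.
by rewrite /discounted big_ord_recr lerDl mulr_ge0 ?exprn_ge0.
Qed.

Lemma limn_discounted (R : realType) (a : R) (D : nat -> R) k :
  cvgn (discounted a D k) -> cvgn (discounted a D k.+1) ->
  limn (discounted a D k) = D k + a * limn (discounted a D k.+1).
Proof.
move=> cvg0 cvg1.
have lhs : discounted a D k n.+1 @[n --> \oo] --> limn (discounted a D k).
  by rewrite cvg_shiftS.
have rhs : discounted a D k n.+1 @[n --> \oo]
    --> D k + a * limn (discounted a D k.+1).
  under eq_fun do rewrite discountedS.
  by apply: cvgD; [exact: cvg_cst | apply: cvgMr].
exact: cvg_unique lhs rhs.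
Qed.

(** Continuity at the excluded endpoint. It lets the treasure tend to a turning point from above; at
    the turning point itself the expected time follows another formula. *)
Lemma affine_ge0_left (R : realFieldType) (a b l r : R) :
  l < r -> (forall d, l < d < r -> 0 <= a + b * (d - l)) -> 0 <= a.
Proof.
move=> lr ge0; rewrite leNgt; apply/negP => a0.
have b1 : 0 < 2 * (1 + `|b|) by have := normr_ge0 b; lra.
pose h := Num.min ((r - l) / 2) (- a / (2 * (1 + `|b|))).
have h0 : 0 < h by rewrite lt_min !divr_gt0//; lra.
have hr : h <= (r - l) / 2 by rewrite ge_min lexx.
have ha : h <= - a / (2 * (1 + `|b|)) by rewrite ge_min lexx orbT.
rewrite ler_pdivlMr// in ha.
have bh : b * h <= `|b| * h by rewrite ler_wpM2r ?ler_norm// ltW.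
have : 0 <= a + b * (l + h - l) by apply: ge0; lra.
lra.
Qed.

(* The treasure at [d] slightly beyond [x n], in the limit [d --> x n]. *)
Lemma competitive_ratio_discounted (R : realType) (p : R) (x : nat -> R)
    (T : R -> R) (C : R) n N (hp : 0 < p < 1)
    (x_gt0 : forall n, 0 < x n) (x_lt : forall n, x n < x n.+1)
    (x_cvg : x n @[n --> \oo] --> +oo%R) (fT : follows x T) :
  (competitive_ratio p T <= C%:E)%E -> 1 <= x n ->
  p * (p * (p * x n * \sum_(j < N) ((1 - p) ^+ 2) ^+ j
    + (discounted ((1 - p) ^+ 2) (departure x) n.+1 N
    + (1 - p) * discounted ((1 - p) ^+ 2) (departure x) n.+2 N))) <= C * x n.
Proof.
move=> CR xn1; set a := (1 - p) ^+ 2; set sa := \sum_(j < N) _.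
set g := _ + _ * discounted _ _ _ _.
have x_le m l : (m <= l)%N -> x m <= x l.
  by move: m l; apply: (homo_leq lexx le_trans) => m; apply: ltW.
have near_xn d : x n < d < x n.+1 -> p * (p * (p * d * sa + g)) <= C * d.
  move=> /andP[d_gt d_lt]; have d1 : 1 <= d by lra.
  have d0 : 0 < d by lra.
  pose P := \sum_(i < N.*2) first_detection_prob p T d i * pass_time T d i.
  have PE : P = p * (p * d * sa + g).
    rewrite /P (partial_expected_time p x_gt0 x_cvg fT (k := n.+1))//.
    - rewrite /g /discounted /sa !mulr_sumr -!big_split /= mulr_sumr.
      by apply: eq_bigr => j _; rewrite !addSn; ring.
    - by move=> i; rewrite ltnS => /x_le; lra.
    - by move=> i /x_le; lra.
  have : (p%:E * P%:E * d^-1%:E <= C%:E)%E.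
    apply: le_trans CR; apply: le_trans (ereal_sup_ubound _); last first.
      by exists d.
    apply: lee_wpmul2r; first by rewrite lee_fin invr_ge0 ltW.
    apply: lee_wpmul2l; first by rewrite lee_fin; lra.
    exact: expected_time_ge.
  by rewrite -!EFinM lee_fin ler_pdivrMr// -PE.
(* The difference of the two sides of [near_xn] is affine in [d], with this slope. *)
rewrite -subr_ge0; apply: (@affine_ge0_left _ _ (C - p * (p * (p * sa)))
  (x n) (x n.+1)) => // d d_itv.
by have := near_xn d d_itv; lra.
Qed.

Lemma competitive_ratio_ge (R : realType) (s : R) (T : R -> R) :
  0 < s < 1 -> monotone_trajectory T ->
  (((4 + 4 * s) / (1 + s ^+ 2) - (1 - s ^+ 2))%:E
     <= competitive_ratio (1 - s ^+ 2) T)%E.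
Proof.
move=> s_itv [x [x_gt0 x_lt x_cvg fT]]; set opt := _ - _.
have /andP[s0 s1] := s_itv.
have s2 : 0 < s ^+ 2 < 1 by rewrite exprn_gt0// exprn_ilt1// ltW.
set p := 1 - s ^+ 2; have hp : 0 < p < 1 by rewrite /p; lra.
have pE : 1 - p = s ^+ 2 by rewrite /p; ring.
rewrite leNgt; apply/negP => CR_lt.
(* The value of [C] for which the constant [c] below satisfies [c * (1 - s ^+ 4) = 1 + s ^+ 2].
   Raising [C] to at least [C0] keeps it below [opt] and secures the lower condition of
   [no_slow_expansion]. *)
pose C0 := 2 + p ^+ 2 / (1 + s ^+ 2).
have C0_lt : C0 < opt.
  rewrite -subr_gt0.
  have -> : opt - C0 = 4 * s / (1 + s ^+ 2).
    by rewrite /opt /C0 /p; field; rewrite gt_eqF//; lra.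
  by rewrite divr_gt0//; lra.
have [C [CR_le C0_le C_lt]] :
    exists C, [/\ (competitive_ratio p T <= C%:E)%E, C0 <= C & C < opt].
  case: (competitive_ratio p T) CR_lt => [r||] // CR_lt; last first.
    by exists C0; rewrite leNye lexx.
  exists (Num.max r C0); rewrite lee_fin !le_max !lexx orbT.
  by rewrite lte_fin in CR_lt; rewrite gt_max CR_lt.
have /cvgryPge/(_ 1)[K _ /= xK] := x_cvg.
have x1 n : (K <= n)%N -> 1 <= x n by exact: xK.
pose D := departure x; pose a := (1 - p) ^+ 2.
have aE : a = s ^+ 4 by rewrite /a pE -exprM.
have a_itv : 0 < a < 1 by rewrite aE exprn_gt0// exprn_ilt1// ltW.
have a_ge0 : 0 <= a by lra.
have D_ge0 n : 0 <= D n by exact: departure_ge0.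
have bound n N : (K <= n)%N ->
    p * (p * (p * x n * \sum_(j < N) a ^+ j
      + (discounted a D n.+1 N + (1 - p) * discounted a D n.+2 N))) <= C * x n.
  move=> /x1.
  exact: (competitive_ratio_discounted N hp x_gt0 x_lt x_cvg fT CR_le).
have g_ge0 k N : 0 <= discounted a D k N by apply: discounted_ge0.
have cvg_g k : (K < k)%N -> cvgn (discounted a D k).
  case: k => // n; rewrite ltnS => Kn.
  (* This bound comes from [bound] by keeping only its first discounted sum, the other summands
     being nonnegative. *)
  apply: (@discounted_is_cvg _ _ _ _ (C * x n / p ^+ 2)) => // N.
  rewrite ler_pdivlMr; last by rewrite exprn_gt0; lra.
  apply: le_trans (bound n N Kn).
  have t1 : 0 <= p * x n * \sum_(j < N) a ^+ j.
    rewrite mulr_ge0 ?sumr_ge0// => [|j _]; last exact: exprn_ge0.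
    by rewrite mulr_ge0 ?(ltW (x_gt0 n))//; lra.
  have t2 : 0 <= (1 - p) * discounted a D n.+2 N by rewrite mulr_ge0//; lra.
  have p_ge0 : 0 <= p by lra.
  rewrite [leLHS]mulrC expr2 -[leLHS]mulrA; do 2!apply: ler_wpM2l => //.
  lra.
pose G k := limn (discounted a D k).
have G_ge0 k : (K < k)%N -> 0 <= G k.
  by move=> /cvg_g cvgk; apply: limr_ge => //; apply: nearW.
have GE k : (K < k)%N -> G k = D k + a * G k.+1.
  by move=> Kk; apply: limn_discounted; apply: cvg_g => //; apply: ltnW.
have G_le n : (K <= n)%N ->
    p * (p * (p * x n / (1 - a) + (G n.+1 + (1 - p) * G n.+2))) <= C * x n.
  move=> Kn; pose F N := p * (p * (p * x n * \sum_(j < N) a ^+ j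
      + (discounted a D n.+1 N + (1 - p) * discounted a D n.+2 N))).
  apply: (@cvgr_to_le _ \oo _ _ F); last first.
    by apply: nearW => N; exact: bound.
  apply: cvgMr; apply: cvgMr; apply: cvgD; last first.
    by apply: cvgD; [|apply: cvgMr]; apply: cvg_g => //; apply: ltnW.
  apply: cvgMr.
  have -> : (fun N => \sum_(j < N) a ^+ j) = (fun N => (1 - a ^+ N) / (1 - a)).
    apply/funext => N; have sumE := subrX1 a N.
    by rewrite -[1 - a ^+ N]opprB sumE; field; lra.
  rewrite -[X in _ --> X]mul1r; apply: cvgMl.
  rewrite -[X in _ --> X]subr0; apply: cvgB; first exact: cvg_cst.
  by apply: cvg_expr; rewrite gtr0_norm; lra.
(* Obtained by solving [G_le] for [A + s ^+ 2 * S], using [1 - a = p * (1 + s ^+ 2)]. At [C = opt],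
   [c * (1 - s ^+ 4)] would equal [(1 + s) ^+ 2]. *)
pose c := (C - p ^+ 2 / (1 + s ^+ 2)) / (2 * p).
have cE : c * (1 - s ^+ 4) = (C * (1 + s ^+ 2) - p ^+ 2) / 2.
  by rewrite /c /p; field; rewrite !gt_eqF//; lra.
(* Summation by parts gives [S] its closed form in [G]. Starting at [K.+1] makes every departure
   time positive, even for [K = 0]. *)
apply: (@no_slow_expansion _ s c (fun i => D (K.+1 + i)%N / 2)
  (fun i => ((1 - a) * G (K.+1 + i).+1 - D (K.+1 + i)%N) / 2)
  (fun i => x (K.+1 + i)%N)) => // [|n|n|n|n|n].
- rewrite cE; apply/andP; split.
    rewrite ler_pdivlMr// -subr_ge0.
    have -> : C * (1 + s ^+ 2) - p ^+ 2 - (1 + s ^+ 2) * 2 =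
        (C - C0) * (1 + s ^+ 2).
      by rewrite /C0; field; rewrite gt_eqF//; lra.
    by rewrite mulr_ge0 ?subr_ge0//; lra.
  rewrite ltr_pdivrMr// -subr_gt0.
  have -> : (1 + s) ^+ 2 * 2 - (C * (1 + s ^+ 2) - p ^+ 2) =
      (opt - C) * (1 + s ^+ 2).
    by rewrite /opt /p; field; rewrite gt_eqF//; lra.
  by rewrite mulr_gt0 ?subr_gt0//; lra.
- rewrite divr_gt0// /D addSn departureS.
  by have := departure_ge0 x_gt0 (K + n); have := x_gt0 (K + n)%N; lra.
- have Kn : (K < (K.+1 + n).+1)%N by rewrite ltnS addSn ltnW// ltnS leq_addr.
  have : 0 <= (1 - a) * G (K.+1 + n).+1 by rewrite mulr_ge0 ?G_ge0//; lra.
  by lra.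
- by rewrite addnS /D departureS; field.
- have Kn : (K < (K.+1 + n).+1)%N by rewrite ltnS addSn ltnW// ltnS leq_addr.
  by rewrite !addnS -aE (GE _ Kn) /D departureS; field.
- set m := (K.+1 + n)%N; have Km : (K <= m)%N by rewrite ltnW// leq_addr.
  have KSm : (K < m.+1)%N by rewrite ltnS.
  (* Unfolding [G m.+1] once leaves [G m.+2] as the only series, the one occurring in [S]. *)
  have := G_le m Km; rewrite (GE _ KSm) addnS -/m => Gm.
  rewrite -subr_ge0.
  have -> : c * x m - (D m.+1 / 2
      + s ^+ 2 * (((1 - a) * G m.+2 - D m.+1) / 2)) =
    (C * x m - p * (p * (p * x m / (1 - a)
      + (D m.+1 + a * G m.+2 + (1 - p) * G m.+2)))) / (2 * p).
    rewrite /c aE pE /p; field; rewrite !gt_eqF//; lra.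
  by rewrite divr_ge0 ?subr_ge0//; lra.
Qed.

Theorem theorem1 (R : realType) (p : R) (hp : 0 < p < 1) :
  let opt : R := (4 + 4 * Num.sqrt (1 - p)) / (2 - p) - p in
  (exists2 T : R -> R,
     monotone_trajectory T & competitive_ratio p T = opt%:E) /\
  (forall T : R -> R,
     monotone_trajectory T -> (opt%:E <= competitive_ratio p T)%E).
Proof.
set s := Num.sqrt (1 - p).
have s2 : s ^+ 2 = 1 - p by rewrite sqr_sqrtr; lra.
have s_itv : 0 < s < 1.
  by rewrite sqrtr_gt0 -[X in _ && (_ < X)]sqrtr1 ltr_sqrt ?ltr01//; lra.
have -> : 2 - p = 1 + s ^+ 2 by rewrite s2; ring.
have -> : p = 1 - s ^+ 2 by rewrite s2; ring.
move=> opt; split; last by move=> T; apply: competitive_ratio_ge.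
(* The geometric trajectory attains the optimum: its upper bound meets the general lower bound. *)
have [b_gt1 _] := optimal_base_itv s_itv.
have bX_gt0 n : 0 < optimal_base s ^+ n by rewrite exprn_gt0//; lra.
have [T fT] := follows_exists bX_gt0 (cvg_expr_pinfty b_gt1).
have mT : monotone_trajectory T.
  exists (fun n => optimal_base s ^+ n); split=> // [n|].
    by rewrite ltr_eXn2l.
  exact: cvg_expr_pinfty.
exists T => //; apply/le_anti/andP; split.
  exact: competitive_ratio_geometric_le.
exact: competitive_ratio_ge.
Qed.
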